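(* Let $p$ be an odd prime and let $G$ be a group of nilpotency class at most two and exponent $p$. Let ${\rm rank}(G^{\rm ab})=n$ with $n>1$, and let ${\rm rank}([G,G])=m$. If $f\bigl(\binom{n}{2}-m+1\bigr)<n$, then $G$ is capable.
   Context: A group $G$ is capable if there exists a group $H$ such that $G\cong H/Z(H)$. $G^{\rm ab}=G/[G,G]$; both $G^{\rm ab}$ and $[G,G]$ are elementary abelian $p$-groups here and rank denotes their ($\mathbb{F}_p$-)dimension (finite). The function $f$ on positive integers is defined as follows: write $k=\binom{T}{2}+s$ with $T,s$ integers, $0\leq s\leq T$; then $f(k)=\binom{T}{3}+\binom{s}{2}$ (this is well defined). *)

(* Defs.v *)
From HB Require Import structures.
From mathcomp Require Import all_boot all_fingroup all_solvable.
From mathcomp Require Import generic_quotient boolp.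

Set Implicit Arguments.
Unset Strict Implicit.
Unset Printing Implicit Defensive.

Import GroupScope.
Local Open Scope quotient_scope.

(* The group H in the definition of capability need not be finite, whereas
   'Z(H) and H / 'Z(H) from fingroup require a finGroupType; the central
   quotient is therefore built for an arbitrary groupType. *)

Section CentralQuotient.
Variable H : groupType.

Definition in_center (x : H) : bool := `[< forall y : H, x * y = y * x >].

Definition eqmod_center (x y : H) : bool := in_center (x^-1 * y).

Lemma in_centerP x : reflect (forall y : H, x * y = y * x) (in_center x).
Proof. exact: asboolP. Qed.

Lemma in_center1 : in_center 1.
Proof. by apply/in_centerP=> y; rewrite mul1g mulg1. Qed.

Lemma in_centerM x y : in_center x -> in_center y -> in_center (x * y).
Proof.
move=> /in_centerP cx /in_centerP cy; apply/in_centerP=> z.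
by rewrite -mulgA cy mulgA (cx z) mulgA.
Qed.

Lemma in_centerV x : in_center x -> in_center x^-1.
Proof.
move=> /in_centerP cx; apply/in_centerP=> z; apply: (mulgI x).
by rewrite mulgA mulgV mul1g mulgA cx -mulgA mulgV mulg1.
Qed.

Lemma eqmod_center_refl : reflexive eqmod_center.
Proof. by move=> x; rewrite /eqmod_center mulVg in_center1. Qed.

Lemma eqmod_center_sym : symmetric eqmod_center.
Proof.
by move=> x y; apply/idP/idP => /in_centerV; rewrite invMg invgK.
Qed.

Lemma eqmod_center_trans : transitive eqmod_center.
Proof.
move=> y x z cxy cyz; rewrite /eqmod_center -(mulKVg y z) mulgA.
exact: in_centerM.
Qed.

Canonical eqmod_center_equiv :=
  EquivRel eqmod_center eqmod_center_refl eqmod_center_sym eqmod_center_trans.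

Definition central_quotient := {eq_quot eqmod_center}.

HB.instance Definition _ := Choice.on central_quotient.
HB.instance Definition _ := EqQuotient.on central_quotient.

Definition cq_one : central_quotient := \pi_central_quotient 1.
Definition cq_mul (a b : central_quotient) : central_quotient :=
  \pi_central_quotient (repr a * repr b).
Definition cq_inv (a : central_quotient) : central_quotient :=
  \pi_central_quotient (repr a)^-1.

Lemma cq_piE x y :
  reflect (\pi_central_quotient x = \pi_central_quotient y) (eqmod_center x y).
Proof. exact: eqmodP. Qed.

Lemma repr_pi x : exists2 z, in_center z &
  repr (\pi_central_quotient x) = x * z.
Proof.
exists (x^-1 * repr (\pi_central_quotient x)); last by rewrite mulKVg.
by apply/cq_piE; rewrite reprK.
Qed.

Lemma pi_mul x y :
  cq_mul (\pi_central_quotient x) (\pi_central_quotient y)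
  = \pi_central_quotient (x * y).
Proof.
rewrite /cq_mul; have [z cz ->] := repr_pi x; have [t ct ->] := repr_pi y.
apply/esym/cq_piE; rewrite /eqmod_center.
have /in_centerP cz' := cz.
rewrite -[x * z * _]mulgA cz' invMg -!mulgA mulKg mulKg.
exact: in_centerM.
Qed.

Lemma pi_inv x :
  cq_inv (\pi_central_quotient x) = \pi_central_quotient x^-1.
Proof.
rewrite /cq_inv; have [z cz ->] := repr_pi x.
apply/esym/cq_piE; rewrite /eqmod_center invgK.
have /in_centerP cz' := in_centerV cz.
by rewrite invMg cz' mulKVg; apply: in_centerV.
Qed.

Lemma central_quotW (P : central_quotient -> Prop) :
  (forall x, P (\pi_central_quotient x)) -> forall a, P a.
Proof. by move=> Ppi a; rewrite -[a]reprK. Qed.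

Lemma cq_mulA : associative cq_mul.
Proof.
elim/central_quotW=> x; elim/central_quotW=> y; elim/central_quotW=> z.
by rewrite (pi_mul y z) (pi_mul x y) (pi_mul x) (pi_mul (x * y)) mulgA.
Qed.

Lemma cq_mul1g : left_id cq_one cq_mul.
Proof. by elim/central_quotW=> x; rewrite (pi_mul 1 x) mul1g. Qed.

Lemma cq_mulg1 : right_id cq_one cq_mul.
Proof. by elim/central_quotW=> x; rewrite (pi_mul x 1) mulg1. Qed.

Lemma cq_mulVg : left_inverse cq_one cq_inv cq_mul.
Proof. by elim/central_quotW=> x; rewrite (pi_inv x) (pi_mul _ x) mulVg. Qed.

Lemma cq_mulgV : right_inverse cq_one cq_inv cq_mul.
Proof. by elim/central_quotW=> x; rewrite (pi_inv x) (pi_mul x) mulgV. Qed.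

HB.instance Definition _ := isGroup.Build central_quotient
  cq_mulA cq_mul1g cq_mulg1 cq_mulVg cq_mulgV.

End CentralQuotient.

Definition group_isomorphic (G K : groupType) : Prop :=
  exists2 phi : G -> K, {morph phi : x y / x * y} & bijective phi.

Definition capable (G : groupType) : Prop :=
  exists H : groupType, group_isomorphic G (central_quotient H).

(* For 0 < k, T is the largest integer with 'C(T, 2) <= k (which forces
   T <= k.+1); f_decomposition and fE show that f is the function defined by
   k = 'C(T, 2) + s, 0 <= s <= T |-> 'C(T, 3) + 'C(s, 2). *)
Definition f (k : nat) : nat :=
  let T := \max_(t < k.+2 | 'C(t, 2) <= k) t in
  'C(T, 3) + 'C(k - 'C(T, 2), 2).

Lemma f_max (k T : nat) : 0 < k -> 'C(T, 2) <= k -> k < 'C(T.+1, 2) ->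
  f k = 'C(T, 3) + 'C(k - 'C(T, 2), 2).
Proof.
move=> k_gt0 leCk ltkC; rewrite /f; set M := \max_(t < _ | _) _.
suffices ->: M = T by [].
have ltT : T < k.+2.
  move: leCk; case: (T) => // t; rewrite binS bin1 !ltnS => /(leq_trans _) -> //.
  exact: leq_addl.
apply/eqP; rewrite eqn_leq; apply/andP; split.
  apply/bigmax_leqP => t Ct; rewrite leqNgt; apply/negP => lt_Tt.
  have := leq_trans ltkC (leq_bin2l 2 lt_Tt).
  by rewrite ltnNge Ct.
exact: (leq_bigmax_cond (Ordinal ltT)).
Qed.

Lemma fE (k T s : nat) :
  0 < k -> s <= T -> k = 'C(T, 2) + s -> f k = 'C(T, 3) + 'C(s, 2).
Proof.
move=> k_gt0; rewrite leq_eqVlt => /predU1P[-> | lt_sT] def_k.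
  have Ck: 'C(T.+1, 2) = k by rewrite def_k binS bin1.
  rewrite (@f_max k T.+1) ?Ck // ?subnn ?addn0 ?[in LHS]binS //.
  by rewrite binS bin1 Ck -[X in X < _]addn0 ltn_add2l.
rewrite (@f_max k T) // def_k ?addKn ?leq_addr //.
by rewrite binS bin1 ltn_add2l.
Qed.

Lemma f_decomposition (k : nat) :
  exists T s : nat, s <= T /\ k = 'C(T, 2) + s.
Proof.
elim: k => [|k [T [s [le_sT ->]]]]; first by exists 0, 0.
move: le_sT; rewrite leq_eqVlt => /predU1P[-> | lt_sT].
  by exists T.+1, 1%N; rewrite binS bin1 addn1.
by exists T, s.+1; rewrite addnS.
Qed.

(* Main.v *)
(* Write V for the abelianization and regard [G, G] as a quotient of the second
   exterior power of V. A bilinear form mu : [G, G] x V -> F_p satisfying the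
   Jacobi identity mu([u, v], w) + mu([v, w], u) + mu([w, u], v) = 0 yields a
   central extension of G by F_p in which a nontrivial y in [G, G] is no longer
   central as soon as mu(y, -) <> 0; elements outside [G, G] are handled by a
   bilinear form on V, as n > 1. If no such mu existed for some y, then by
   duality there would be an n-dimensional space of trivectors whose
   contractions all lie in the space of relations between the commutators
   modulo y, which has dimension k = C(n, 2) - m + 1. Taking leading terms, these
   trivectors become n triangles in a graph with k edges, while by the
   Kruskal-Katona bound such a graph has at most f(k) < n triangles. *)
Require Import Defs.
From HB Require Import structures.
From mathcomp Require Import all_boot all_fingroup all_solvable all_algebra.
From mathcomp Require Import mxabelem generic_quotient boolp zify ring.

Set Implicit Arguments.
Unset Strict Implicit.
Unset Printing Implicit Defensive.
Import GRing.Theory.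

(** * Triangles in a graph with a given number of edges *)

Lemma bin2D (a b : nat) : 'C(a + b, 2) = 'C(a, 2) + 'C(b, 2) + a * b.
Proof. elim: a => [|a IH]; [by rewrite !add0n mul0n addn0 | rewrite addSn !binS !bin1 IH]; lia. Qed.

(** [fE] needs a positive argument; at [0] both sides vanish, a case reached when the last edges of
    a graph are deleted. *)
Lemma f_binE (T s : nat) : s <= T -> f ('C(T, 2) + s) = 'C(T, 3) + 'C(s, 2).
Proof.
move=> le_sT; have [k0|k_gt0] := posnP ('C(T, 2) + s); last exact: fE.
have T0 : 'C(T, 2) = 0 by lia.
have s0 : s = 0 by lia.
rewrite s0 addn0 T0 bin_small; last by apply: ltnW; rewrite ltnS ltnNge -bin_gt0 T0.
by rewrite add0n /f big_mkcond !big_ord_recr big_ord0.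
Qed.

(** Deleting a vertex of degree [d] costs [d] edges and at most ['C(d, 2)] triangles. With
    [k = 'C(T, 2) + s] and [s < T], the hypothesis forces [d < T]; then [d] is subtracted from [s]
    if possible, and otherwise partly borrowed from ['C(T, 2)]. *)
Lemma f_add_bin2 (k d : nat) : 'C(d.+1, 2) <= k -> f (k - d) + 'C(d, 2) <= f k.
Proof.
move=> le_dk.
have [T [s [lt_sT def_k]]] : exists T s : nat, s < T /\ k = 'C(T, 2) + s.
  have [T [s [le_sT ->]]] := f_decomposition k.
  move: le_sT; rewrite leq_eqVlt => /predU1P[->|lt_sT]; last by exists T, s.
  by exists T.+1, 0; rewrite binS bin1 addn0.
have lt_dT : d.+1 <= T.
  rewrite leqNgt; apply/negP => lt_Td.
  have := leq_trans (leq_bin2l 2 lt_Td) le_dk.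
  by rewrite def_k binS bin1; lia.
case: T lt_sT def_k lt_dT => [|T] // lt_sT def_k lt_dT.
have -> : f k = 'C(T.+1, 3) + 'C(s, 2) by rewrite def_k f_binE // ltnW.
have [le_ds|lt_sd] := leqP d s.
  have -> : k - d = 'C(T.+1, 2) + (s - d) by lia.
  rewrite f_binE; last lia.
  by rewrite -addnA leq_add2l -[X in _ <= 'C(X, 2)](subnK le_ds) bin2D leq_addr.
have -> : k - d = 'C(T, 2) + (T + s - d) by rewrite def_k binS bin1; lia.
rewrite f_binE; last lia.
(* After expanding with [T = d + x], what remains is [s * x <= d * x]. *)
have [x def_T] : exists x, T = d + x by exists (T - d); lia.
have -> : T + s - d = s + x by lia.
by rewrite [in 'C(T.+1, 3)]binS -!addnA leq_add2l def_T !bin2D; nia.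
Qed.

Lemma f_mono : {homo f : j k / j <= k}.
Proof.
move=> j k; apply: (homo_leq (fun=> leqnn _) leq_trans) => {j k}i.
by have := @f_add_bin2 i.+1 1 isT; rewrite subSS subn0 addn0.
Qed.

Section Triangles.
Variable T : finType.
Implicit Types (E : {set {set T}}) (S : {set T}).

Definition triangles E : {set {set T}} :=
  [set S : {set T} | (#|S| == 3) && [forall v in S, S :\ v \in E]].


(* Delete a vertex of least positive degree [d]: it lies on at most ['C(d, 2)]
   triangles, and the degree sum gives ['C(d.+1, 2) <= #|E|]. *)
Lemma card_triangles E : {in E, forall S, #|S| = 2} -> #|triangles E| <= f #|E|.
Proof.
have [k] := ubnP #|E|; elim: k E => // k IHk E; rewrite ltnS => leEk E2.
pose star v := [set S in E | v \in S].
pose nbr v := [set y | [set v; y] \in E].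
have nbrE v y : y \in nbr v -> v != y.
  by rewrite inE => /E2; rewrite cards2; case: eqP.
have card_star v : #|nbr v| = #|star v|.
  rewrite -(@card_in_imset _ _ (fun y => [set v; y])) => [|y z yv zv eq_yz].
    congr #|pred_of_set _|; apply/setP=> S; apply/imsetP/setIdP => [[y]|[SE vS]].
      by rewrite inE => yE ->; rewrite yE !inE eqxx.
    have /cards2P[a [b [neq_ab defS]]] : #|S| == 2 by rewrite E2.
    move: SE vS; rewrite defS !inE => SE /pred2P[]->; first by exists b; rewrite ?inE.
    by exists a; rewrite ?inE setUC.
  have := set22 v y; rewrite eq_yz !inE eq_sym (negPf (nbrE v y yv)).
  by move/eqP.
have [E0|[S0 S0E]] := set_0Vmem E.
  rewrite E0 (_ : triangles set0 = set0) ?cards0 //.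
  apply/setP=> S; rewrite !inE; apply/andP=> [[/eqP S3 /forall_inP allS]].
  have /card_gt0P[v /allS] : 0 < #|S| by rewrite S3.
  by rewrite inE.
have [v0 v0S0] : exists v, v \in S0 by apply/card_gt0P; rewrite E2.
pose cov := [set v | 0 < #|star v|].
have covP S v : S \in E -> v \in S -> v \in cov.
  by move=> SE vS; rewrite inE; apply/card_gt0P; exists S; rewrite inE SE.
have := @arg_minnP _ v0 (mem cov) (fun v => #|star v|) (covP _ _ S0E v0S0).
case=> v v_cov min_v; set d := #|star v| in min_v.
have handshake : \sum_(u in cov) #|star u| = #|E| * 2.
  rewrite -sum_nat_const.
  transitivity (\sum_u \sum_(S in E) (u \in S)).
    rewrite [RHS](bigID (mem cov)) /= [X in _ = _ + X]big1 ?addn0.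
      apply: eq_bigr => u _; rewrite -sum1_card -big_mkcondr.
      by apply: eq_bigl => S; rewrite inE.
    move=> u uN; apply: big1 => S SE; apply/eqP; rewrite eqb0.
    by apply: contra uN; apply: covP.
  rewrite exchange_big /=; apply: eq_bigr => S SE.
  by rewrite -(E2 S SE) -sum1_card -big_mkcond.
have d_gt0 : 0 < d by have: v \in cov := v_cov; rewrite inE.
(* [v] and its [d] neighbours all have positive degree, hence degree at least [d] by minimality. *)
have lt_d_cov : d < #|cov|.
  apply: leq_trans (subset_leq_card (_ : v |: nbr v \subset cov)).
    by rewrite cardsU1 card_star; case: (boolP (_ \in _)) => // /nbrE; rewrite eqxx.
  apply/subsetP=> u /setU1P[-> //|]; rewrite [u \in nbr v]inE => uE.
  by apply: covP uE _; rewrite set22.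
have le_dE : 'C(d.+1, 2) <= #|E|.
  have : \sum_(u in cov) d <= #|E| * 2 by rewrite -handshake leq_sum.
  rewrite sum_nat_const => le_cd; have := leq_mul lt_d_cov (leqnn d) => le_dd.
  have := leq_trans le_dd le_cd.
  by have := mul_bin_diag d.+1 1; rewrite bin1 /=; lia.
have card_E' : #|E :\: star v| = #|E| - d.
  rewrite cardsD (setIidPr _) //; apply/subsetP=> S; rewrite inE.
  by case/andP.
apply: leq_trans (f_add_bin2 le_dE); rewrite -card_E'.
(* A triangle through [v] is determined by its opposite edge, a pair of neighbours of [v]. *)
have le_star : #|[set S in triangles E | v \in S]| <= 'C(d, 2).
  rewrite /d -card_star -cards_draws.
  rewrite -(@card_in_imset _ _ (fun S => S :\ v) [set S in triangles E | v \in S]) => [|S S'].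
    apply: subset_leq_card; apply/subsetP=> _ /imsetP[S + ->].
    rewrite !inE => /andP[/andP[/eqP S3 /forall_inP tS] vS].
    have Sv2 : #|S :\ v| = 2 by apply: E2 (tS v vS).
    rewrite Sv2 eqxx andbT; apply/subsetP=> y yS; rewrite inE.
    have /cards1P[z Sz] : #|S :\ v :\ y| == 1.
      by have := cardsD1 y (S :\ v); rewrite yS Sv2; lia.
    have zS : z \in S :\ v :\ y by rewrite Sz set11.
    move: yS zS; rewrite !inE => /andP[nyv yS] /and3P[nzy nzv zS].
    have -> : [set v; y] = S :\ z; last exact: tS.
    apply/setP=> u; rewrite !inE; have := congr1 (fun A : {set T} => u \in A) Sz.
    rewrite !inE; case: (eqVneq u z) => [->|_] /=.
      by rewrite (negPf nzy) (negPf nzv).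
    case: (eqVneq u v) => [->|_] /=; first by rewrite vS.
    by case: (eqVneq u y) => [->|_]; rewrite ?yS ?orbT /= ?andbT => // ->.
  rewrite !inE => /andP[_ vS] /andP[_ vS'] eqS.
  by rewrite -(setD1K vS) eqS setD1K.
have lt_E'k : #|E :\: star v| < k.
  have d_leE : d <= #|E|.
    by apply: subset_leq_card; apply/subsetP=> S; rewrite inE => /andP[].
  by rewrite card_E'; lia.
have E'2 : {in E :\: star v, forall S, #|S| = 2} by move=> S /setDP[SE _]; apply: E2.
apply: leq_trans (leq_add (IHk _ lt_E'k E'2) le_star).
(* Triangles avoiding [v] survive the deletion of its star. *)
rewrite -(cardsID [set S : {set T} | v \in S] (triangles E)) addnC leq_add //.
  apply: subset_leq_card; apply/subsetP=> S; rewrite !inE.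
  case/and3P=> vS -> /forall_inP tS /=; apply/forall_inP=> u uS.
  by rewrite inE tS // andbT !inE (negPf vS) !andbF.
by apply: subset_leq_card; apply/subsetP=> S; rewrite !inE.
Qed.
End Triangles.

(** An increasing tuple is the same data as its underlying set, so the triangle bound transfers to
    leading triples and pairs. *)
Lemma card_ordered_triangles n (Q : rel 'I_n) :
  #|[set t : 'I_n * 'I_n * 'I_n | let: (i, j, k) := t in
       [&& i < j, j < k, Q i j, Q i k & Q j k]]|
  <= f #|[set ij : 'I_n * 'I_n | (ij.1 < ij.2) && Q ij.1 ij.2]|.
Proof.
set P3 := [set t : 'I_n * 'I_n * 'I_n | _]; set P2 := [set ij : 'I_n * 'I_n | _].
pose E := [set [set ij.1; ij.2] | ij in P2].
have EP (i j : 'I_n) : i < j -> Q i j -> [set i; j] \in E.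
  by move=> ltij Qij; apply/imsetP; exists (i, j); rewrite // inE ltij.
apply: leq_trans (f_mono (leq_imset_card _ _ : #|E| <= #|P2|)).
have E2 : {in E, forall S : {set 'I_n}, #|S| = 2}.
  by move=> _ /imsetP[[i j] + ->]; rewrite inE cards2 neq_ltn => /andP[->].
apply: leq_trans (card_triangles E2).
pose h (t : 'I_n * 'I_n * 'I_n) := [set t.1.1; t.1.2; t.2].
rewrite -(@card_in_imset _ _ h P3) => [|[[i j] k] [[i' j'] k']].
  apply: subset_leq_card; apply/subsetP=> _ /imsetP[[[i j] k] + ->].
  rewrite !inE => /and5P[ltij ltjk Qij Qik Qjk].
  have nij : (i == j) = false by rewrite -val_eqE /=; lia.
  have njk : (j == k) = false by rewrite -val_eqE /=; lia.
  have nik : (i == k) = false by rewrite -val_eqE /=; lia.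
  have ltik := ltn_trans ltij ltjk.
  rewrite cardsU cards2 cards1 nij (_ : _ :&: _ = set0) ?cards0 /=; last first.
    by apply/setP=> u; rewrite !inE;
      case: (eqVneq u k) => [->|]; rewrite ?andbF // 1?eq_sym nik eq_sym njk.
  apply/forall_inP=> v; rewrite !inE -orbA => /or3P[] /eqP->.
  - rewrite (_ : _ :\ _ = [set j; k]) ?EP //.
    by apply/setP=> u; rewrite !inE; case: (eqVneq u i) => [->|] //=; rewrite nij nik.
  - rewrite (_ : _ :\ _ = [set i; k]) ?EP //.
    by apply/setP=> u; rewrite !inE;
      case: (eqVneq u j) => [->|_] /=; rewrite ?orbF // eq_sym nij njk.
  - rewrite (_ : _ :\ _ = [set i; j]) ?EP //.
    by apply/setP=> u; rewrite !inE;
      case: (eqVneq u k) => [->|_] /=; rewrite ?orbF // eq_sym nik eq_sym njk.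
rewrite !inE => /and5P[lij ljk _ _ _] /and5P[lij' ljk' _ _ _] eqh.
have mem u : (u == i) || (u == j) || (u == k) = (u == i') || (u == j') || (u == k').
  by have := congr1 (fun A : {set _} => u \in A) eqh; rewrite !inE.
have := (mem i, mem j, mem k, mem i', mem j', mem k').
rewrite !eqxx ?orbT /= -!val_eqE /= => -[[[[[h1 h2] h3] h4] h5] h6].
suff [e1 e2 e3] : [/\ i = i' :> nat, j = j' :> nat & k = k' :> nat].
  by congr (_, _, _); apply: val_inj.
by clear -lij ljk lij' ljk' h1 h2 h3 h4 h5 h6; split; lia.
Qed.

(** * Jacobi pairings *)

Section LinearSystems.
Local Open Scope ring_scope.

(** The rows of [K = 1 - A *m pinvmx A] solve the system, so [K *m B = 0], which reads
    [B = A *m (pinvmx A *m B)] and makes the coefficients explicit. *)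
Lemma linear_form_in_span (F : fieldType) (Q R : finType) (a : R -> Q -> F) (b : Q -> F) :
    (forall x : Q -> F, (forall r, \sum_q x q * a r q = 0) -> \sum_q x q * b q = 0) ->
  exists d : R -> F, forall q, b q = \sum_r d r * a r q.
Proof.
move=> ker_b.
pose A := \matrix_(q < #|Q|, r < #|R|) a (enum_val r) (enum_val q).
pose B := \col_(q < #|Q|) b (enum_val q).
pose K := 1%:M - A *m pinvmx A.
have KA0 : K *m A = 0 by rewrite mulmxBl mul1mx mulmxKpV ?subrr.
have KB0 : K *m B = 0.
  apply/matrixP=> i j; rewrite !mxE.
  rewrite -[RHS](ker_b (fun q => K i (enum_rank q))) => [|r].
    rewrite (reindex enum_rank) /=; last by apply: onW_bij; apply: enum_rank_bij.
    by apply: eq_bigr => q _; rewrite !mxE enum_rankK.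
  have := congr1 (fun M : 'M_(_, _) => M i (enum_rank r)) KA0; rewrite !mxE => {2}<-.
  rewrite [RHS](reindex enum_rank) /=; last by apply: onW_bij; apply: enum_rank_bij.
  by apply: eq_bigr => q _; rewrite !mxE !enum_rankK.
have defB : B = A *m (pinvmx A *m B).
  by apply/eqP; rewrite -subr_eq0 mulmxA -{1}[B]mul1mx -mulmxBl -/K KB0.
exists (fun r => (pinvmx A *m B) (enum_rank r) 0) => q.
have := congr1 (fun M : 'M_(_, _) => M (enum_rank q) 0) defB.
rewrite [LHS]mxE enum_rankK => ->; rewrite mxE.
rewrite (reindex enum_rank) /=; last by apply: onW_bij; apply: enum_rank_bij.
by apply: eq_bigr => r _; rewrite [A _ _]mxE !enum_rankK mulrC.
Qed.

Lemma nontrivial_solution (F : fieldType) n (I : finType) (a : I -> 'I_n -> F) :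
  (#|I| < n)%N -> exists2 x : 'rV[F]_n, x != 0 & forall i, \sum_l x 0 l * a i l = 0.
Proof.
move=> ltIn; pose A := \matrix_(l < n, i < #|I|) a (enum_val i) l.
have : kermx A != 0.
  by rewrite kermx_eq0 /row_free neq_ltn (leq_ltn_trans (rank_leq_col A)).
case/rowV0Pn=> x /sub_kermxP xA0 nz_x; exists x => // i.
have := congr1 (fun M : 'M_(_, _) => M 0 (enum_rank i)) xA0; rewrite !mxE => {2}<-.
by apply: eq_bigr => l _; rewrite mxE enum_rankK.
Qed.

Lemma card_ordered_pairs n : #|[set ij : 'I_n * 'I_n | (ij.1 < ij.2)%N]| = 'C(n, 2).
Proof.
rewrite -sum1_card -bin2_sum big_mkord.
transitivity (\sum_(i < n) \sum_(j < n | (i < j)%N) 1)%N.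
  by rewrite pair_big_dep /=; apply: eq_bigl => ij; rewrite inE.
rewrite (exchange_big_dep predT) //=; apply: eq_bigr => j _.
by rewrite -(big_ord_widen n (fun=> 1%N)) ?sum1_card ?card_ord // ltnW.
Qed.

(* The weights [2 ^ i] order pairs and triples compatibly with adding a common
   index, so contracting a leading triple yields a leading pair. *)
Definition weight n (ij : 'I_n * 'I_n) : nat := 2 ^ ij.1 + 2 ^ ij.2.

(** The larger index is read off first, since [2 ^ i + 2 ^ j < 2 ^ j.+1] for [i < j]. *)
Lemma weight_inj n (ij kl : 'I_n * 'I_n) : (ij.1 < ij.2)%N -> (kl.1 < kl.2)%N ->
  weight ij = weight kl -> ij = kl.
Proof.
case: ij kl => [i j] [k l] /= ltij ltkl; rewrite /weight /= => eqw.
have exp_lt a b : (a < b -> 2 ^ a.+1 <= 2 ^ b)%N by move=> ?; apply: leq_pexp2l.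
have pos a : (0 < 2 ^ a)%N by rewrite expn_gt0.
have ejl : j = l :> nat.
  have [ltjl|ltlj|//] := ltngtP j l.
    have := exp_lt _ _ ltjl; have := exp_lt _ _ ltij; have := pos k; have := pos i.
    by rewrite !expnS; lia.
  have := exp_lt _ _ ltlj; have := exp_lt _ _ ltkl; have := pos k; have := pos i.
  by rewrite !expnS; lia.
congr (_, _); apply: val_inj => //=.
by apply: (@expnI 2) => //; move: eqw; rewrite ejl; lia.
Qed.

(** Sorting by transpositions only changes signs, so the value stays nonzero, and the sum of powers
    is symmetric. Two equal indices would make the value zero. *)
Lemma alternating_sort (V : zmodType) n (om : 'I_n -> 'I_n -> 'I_n -> V) :
    (forall i j k, om i j k = - om j i k) -> (forall i j k, om i j k = - om i k j) ->
    (forall i k, om i i k = 0) ->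
  forall i j k, om i j k != 0 -> exists a b c : 'I_n,
    [/\ (a < b < c)%N, om a b c != 0 & (2 ^ a + 2 ^ b + 2 ^ c = 2 ^ i + 2 ^ j + 2 ^ k)%N].
Proof.
move=> swapl swapr alt i j k nz.
have [u [v [lt_uv nz_uv eq_uv]]] : exists u v : 'I_n,
    [/\ (u < v)%N, om u v k != 0 & (2 ^ u + 2 ^ v = 2 ^ i + 2 ^ j)%N].
  have [lt_ij|lt_ji|/val_inj eq_ij] := ltngtP i j; first by exists i, j.
    by exists j, i; rewrite -oppr_eq0 -swapl addnC.
  by rewrite eq_ij alt eqxx in nz.
rewrite -eq_uv; have [lt_vk|lt_kv|/val_inj eq_vk] := ltngtP v k.
- by exists u, v, k; rewrite lt_uv.
- have nz_ukv : om u k v != 0 by rewrite -oppr_eq0 -swapr.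
  have [lt_uk|lt_ku|/val_inj eq_uk] := ltngtP u k.
  + by exists u, k, v; rewrite lt_uk lt_kv; split=> //; lia.
  + by exists k, u, v; rewrite lt_ku lt_uv -oppr_eq0 -swapl; split=> //; lia.
  + by rewrite eq_uk alt eqxx in nz_ukv.
- by move: nz_uv; rewrite -eq_vk swapl swapr alt !oppr0 eqxx.
Qed.

End LinearSystems.

(** * Existence of Jacobi pairings by duality and leading terms *)

Section JacobiPairing.
Local Open Scope ring_scope.
Variables (F : fieldType) (n m : nat) (C : 'I_n -> 'I_n -> 'rV[F]_m) (y : 'rV[F]_m).
Hypothesis skewC : forall i j, C i j = - C j i.
Hypothesis altC : forall i, C i i = 0.
Hypothesis spanC : forall U : 'M[F]_m, (forall i j, (C i j <= U)%MS) -> row_full U.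

Definition low_span w : 'M[F]_m :=
  (\sum_(ij : 'I_n * 'I_n | (weight ij < w)%N) <<C ij.1 ij.2>>)%MS.

(** When the [C i j] are adjoined to [y] by increasing weight, these pairs do not enlarge the span;
    for [i < j] they are the leading pairs of relations modulo [y]. *)
Definition dependent i j := (C i j <= y + low_span (weight (i, j)))%MS.

(** The increasing pairs that are not dependent are a greedy spanning set: with [y] they span all
    [m] dimensions, so there are at least [m - 1] of them. *)
Lemma card_dependent :
  (#|[set ij : 'I_n * 'I_n | (ij.1 < ij.2)%N && dependent ij.1 ij.2]|
   <= 'C(n, 2) - m + 1)%N.
Proof.
set P := [set ij | _ & _].
pose Bs := [set ij : 'I_n * 'I_n | (ij.1 < ij.2)%N && ~~ dependent ij.1 ij.2].
have cardPB : (#|P| + #|Bs| = 'C(n, 2))%N.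
  rewrite -card_ordered_pairs -[RHS](cardsID [set ij | dependent ij.1 ij.2]).
  by congr (_ + _)%N; apply: eq_card => ij; rewrite !inE // andbC.
pose U := (y + \sum_(ij in Bs) <<C ij.1 ij.2>>)%MS.
(* Induction on the weight: a dependent vector is a combination of [y] and lighter vectors. *)
have C_U i j : (C i j <= U)%MS.
  have [w] := ubnP (weight (i, j)); elim: w => // w IHw in i j *; rewrite ltnS => le_w.
  wlog lt_ij : i j le_w / (i < j)%N => [wlog_ij|].
    have [lt_ij|lt_ji|/val_inj->] := ltngtP i j; first exact: wlog_ij.
      by rewrite skewC eqmx_opp wlog_ij // /weight addnC.
    by rewrite altC sub0mx.
  have [dep|indep] := boolP (dependent i j).
    apply: submx_trans dep _; rewrite addsmx_sub addsmxSl /=.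
    apply/sumsmx_subP=> -[k l] /= lt_kl; rewrite genmxE IHw //.
    exact: leq_trans le_w.
  apply: submx_trans (addsmxSr _ _).
  by apply: (sumsmx_sup (i, j)); rewrite ?genmxE // inE lt_ij.
have : (\rank U <= 1 + #|Bs|)%N.
  apply: leq_trans (mxrank_adds_leqif _ _).1 _; rewrite leq_add ?rank_leq_row //.
  apply: leq_trans (mxrank_sum_leqif _).1 _; rewrite -sum1_card /=.
  by apply: leq_sum => ij _; rewrite mxrank_gen rank_leq_row.
have /eqP-> := spanC C_U; move: cardPB; lia.
Qed.

Definition antisym (D : 'I_n * 'I_n * 'I_n -> F) i j k :=
  D (i, j, k) + D (j, k, i) + D (k, i, j) - D (j, i, k) - D (i, k, j) - D (k, j, i).

(* Dually, if [y] pairs to zero under every Jacobi pairing then each linear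
   form [fun N => (y *m N) 0 l] is a combination of Jacobi sums; [antisym] of
   its coefficients is a trivector whose contractions are relations among the
   [C i j] modulo [y]. *)
Lemma contraction_trivector :
    (forall N : 'M[F]_(m, n), (forall i j k,
       (C i j *m N) 0 k + (C j k *m N) 0 i + (C k i *m N) 0 j = 0) -> y *m N = 0) ->
  exists D : 'I_n -> 'I_n * 'I_n * 'I_n -> F, forall l k,
    \sum_(ij : 'I_n * 'I_n | (ij.1 < ij.2)%N) antisym (D l) ij.1 ij.2 k *: C ij.1 ij.2
    = (k == l)%:R *: y.
Proof.
move=> yN0.
(* The Jacobi sum at [t] as a linear form in the entries of [N]; [b l] is likewise entry [l] of
   [y *m N]. *)
pose a (t : 'I_n * 'I_n * 'I_n) (q : 'I_m * 'I_n) : F := let: (i, j, k) := t in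
  C i j 0 q.1 * (q.2 == k)%:R + C j k 0 q.1 * (q.2 == i)%:R
  + C k i 0 q.1 * (q.2 == j)%:R.
pose b (l : 'I_n) (q : 'I_m * 'I_n) : F := y 0 q.1 * (q.2 == l)%:R.
have sumE (x : 'I_m * 'I_n -> F) (z : 'rV[F]_m) (k : 'I_n) :
    \sum_q x q * (z 0 q.1 * (q.2 == k)%:R) = (z *m \matrix_(r, l) x (r, l)) 0 k.
  rewrite mxE; transitivity (\sum_r \sum_l x (r, l) * (z 0 r * (l == k)%:R)).
    by rewrite pair_bigA; apply: eq_bigr => -[].
  apply: eq_bigr => r _; rewrite (bigD1 k) //= eqxx mulr1 mxE mulrC big1 ?addr0 //.
  by move=> l /negPf->; rewrite !mulr0.
have /fin_all_exists[D defD] : forall l, exists d, forall q, b l q = \sum_t d t * a t q.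
  move=> l; apply: linear_form_in_span => x xa0; rewrite sumE yN0 ?mxE // => i j k.
  rewrite -[RHS](xa0 (i, j, k)) -!sumE -!big_split /=.
  by apply: eq_bigr => q _; rewrite !mulrDr.
exists D => l k.
(* The three cyclic positions in which [C i j] enters a Jacobi sum. *)
pose E i j := D l (i, j, k) + D l (k, i, j) + D l (j, k, i).
have <- : \sum_i \sum_j E i j *: C i j = (k == l)%:R *: y.
  apply/rowP=> r; rewrite summxE [RHS]mxE mulrC.
  have := defD l (r, k); rewrite /b /= => ->.
  have deltaE (g : 'I_n -> F) : \sum_k' g k' * (k == k')%:R = g k.
    rewrite (bigD1 k) //= eqxx mulr1 big1 ?addr0 // => k' nkk'.
    by rewrite eq_sym (negPf nkk') mulr0.
  transitivity (\sum_i \sum_j \sum_k' D l (i, j, k') * a (i, j, k') (r, k)); last first.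
    by rewrite !pair_bigA; apply: eq_bigr => -[[]].
  under eq_bigr => i _ do rewrite summxE.
  under [RHS]eq_bigr => i _ do under eq_bigr => j _ do
    under eq_bigr => k' _ do rewrite /a /= !mulrDr.
  under [RHS]eq_bigr => i _ do under eq_bigr => j _ do rewrite !big_split /=.
  under [RHS]eq_bigr => i _ do rewrite !big_split /=.
  rewrite !big_split /=.
  under eq_bigr => i _ do under eq_bigr => j _ do rewrite mxE /E !mulrDl.
  under eq_bigr => i _ do rewrite !big_split /=.
  rewrite !big_split /=; congr (_ + _ + _).
  - apply: eq_bigr => i _; apply: eq_bigr => j _.
    by under [RHS]eq_bigr => k' _ do rewrite mulrA; rewrite deltaE.
  - rewrite [RHS]exchange_big /=; apply: eq_bigr => i _.
    rewrite [RHS]exchange_big /=; apply: eq_bigr => j _.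
    by under [RHS]eq_bigr => k' _ do rewrite mulrA; rewrite deltaE.
  - rewrite exchange_big /=; apply: eq_bigr => i _.
    rewrite [RHS]exchange_big /=; apply: eq_bigr => j _.
    by under [RHS]eq_bigr => k' _ do rewrite mulrA; rewrite deltaE.
(* Diagonal terms vanish and terms with [j < i] fold onto [i < j] with a sign; the coefficient
   becomes [E i j - E j i], which is [antisym]. *)
rewrite pair_bigA [RHS](bigID (fun ij : 'I_n * 'I_n => (ij.1 < ij.2)%N)) /=.
rewrite [X in _ + X](bigID (fun ij : 'I_n * 'I_n => (ij.2 < ij.1)%N)) /=.
rewrite [X in _ + (_ + X)]big1 ?addr0 => [|[i j] /= /andP[]]; last first.
  by rewrite -!leqNgt => le_ji le_ij;
    rewrite (_ : i = j) ?altC ?scaler0 //; apply/val_inj/anti_leq/andP.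
pose swap (ij : 'I_n * 'I_n) := (ij.2, ij.1).
have swapK : involutive swap by case.
rewrite [X in _ + X](reindex_inj (inv_inj swapK)) /=.
rewrite [X in _ + X](eq_bigl (fun ij : 'I_n * 'I_n => (ij.1 < ij.2)%N)) => [|ij];
  last by rewrite /=; lia.
rewrite -big_split /=; apply: eq_bigr => -[i j] /= _.
rewrite (skewC j i) scalerN -scalerBl; congr (_ *: _).
by rewrite /antisym /E; ring.
Qed.

(** By the triangle bound [P3] has fewer than [n] triples, so some combination [om] of the
    trivectors, with nonzero coefficients [x], vanishes on [P3]. A triple of largest weight with
    [om] nonzero would lie in [P3]; hence [om] is zero, and contracting gives [x 0 k *: y = 0] for
    all [k]. *)
Theorem exists_jacobi_pairing :
    y != 0 -> (f ('C(n, 2) - m + 1) < n)%N ->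
  exists2 N : 'M[F]_(m, n),
    forall i j k, (C i j *m N) 0 k + (C j k *m N) 0 i + (C k i *m N) 0 j = 0
    & y *m N != 0.
Proof.
move=> nz_y lt_f; apply: contrapT => noN.
have [D contrD] : exists D : 'I_n -> 'I_n * 'I_n * 'I_n -> F, forall l k,
    \sum_(ij : 'I_n * 'I_n | (ij.1 < ij.2)%N) antisym (D l) ij.1 ij.2 k *: C ij.1 ij.2
    = (k == l)%:R *: y.
  apply: contraction_trivector => N jacN; apply/eqP/negPn/negP => nz_yN.
  by apply: noN; exists N.
pose P3 := [set t : 'I_n * 'I_n * 'I_n | let: (i, j, k) := t in
  [&& (i < j)%N, (j < k)%N, dependent i j, dependent i k & dependent j k]].
have lt_P3 : (#|{: {t | t \in P3}}| < n)%N.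
  rewrite card_sig; apply: leq_ltn_trans lt_f.
  apply: leq_trans (f_mono card_dependent); apply: leq_trans (card_ordered_triangles dependent).
  by apply: subset_leq_card; apply/subsetP=> t.
have [x nz_x xP3] := nontrivial_solution
  (fun (t : {t | t \in P3}) l => antisym (D l) (val t).1.1 (val t).1.2 (val t).2) lt_P3.
pose om i j k := \sum_l x 0 l * antisym (D l) i j k.
have om_contr k : \sum_(ij : 'I_n * 'I_n | (ij.1 < ij.2)%N) om ij.1 ij.2 k *: C ij.1 ij.2
    = x 0 k *: y.
  under eq_bigr => ij _ do rewrite scaler_suml.
  rewrite exchange_big /= (bigD1 k) //= [X in _ + X]big1 ?addr0 => [|l nlk].
    under eq_bigr => ij _ do rewrite -scalerA.
    by rewrite -scaler_sumr contrD eqxx scale1r.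
  under eq_bigr => ij _ do rewrite -scalerA.
  by rewrite -scaler_sumr contrD eq_sym (negPf nlk) scale0r scaler0.
have om_swapl i j k : om i j k = - om j i k.
  by rewrite -sumrN; apply: eq_bigr => l _; rewrite /antisym; ring.
have om_swapr i j k : om i j k = - om i k j.
  by rewrite -sumrN; apply: eq_bigr => l _; rewrite /antisym; ring.
have om_alt i k : om i i k = 0.
  by apply: big1 => l _; rewrite /antisym; ring.
have om_sort := alternating_sort om_swapl om_swapr om_alt.
have om0 i j k : om i j k = 0.
  apply/eqP/negPn/negP => nz_ijk; have [a [b [c [lt_abc nz_abc _]]]] := om_sort _ _ _ nz_ijk.
  clear nz_ijk.
  pose good (t : 'I_n * 'I_n * 'I_n) := (t.1.1 < t.1.2 < t.2)%N && (om t.1.1 t.1.2 t.2 != 0).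
  pose w3 (t : 'I_n * 'I_n * 'I_n) := (2 ^ t.1.1 + 2 ^ t.1.2 + 2 ^ t.2)%N.
  have good_abc : good (a, b, c) by rewrite /good /= lt_abc.
  case: (arg_maxnP w3 good_abc) => -[[{}i {}j] {}k] /andP[/= /andP[lt_ij lt_jk] nz] max_t.
  (* Contraction with [t] is a relation modulo [y]; by maximality its other nonzero terms are
     lighter than [(u, v)], which is therefore a leading pair. *)
  have dep (u v t : 'I_n) : (u < v)%N -> om u v t != 0 ->
    w3 (u, v, t) = w3 (i, j, k) -> dependent u v.
    move=> lt_uv nz_uvt eqw; have := om_contr t.
    rewrite (bigD1 (u, v)) //= => /(canRL (addrK _)) def_uv.
    rewrite /dependent -(eqmx_scale _ nz_uvt) def_uv addmx_sub ?scalemx_sub ?addsmxSl //.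
    rewrite eqmx_opp summx_sub // => -[u' v'] /andP[/= lt_uv' neq].
    have [->|nz_uvt'] := eqVneq (om u' v' t) 0; first by rewrite scale0r sub0mx.
    apply/scalemx_sub/(submx_trans _ (addsmxSr _ _))/(sumsmx_sup (u', v')); last by rewrite genmxE.
    have [a' [b' [c' [lt' nz' eqw']]]] := om_sort _ _ _ nz_uvt'.
    have := max_t (a', b', c'); rewrite /good /= lt' => /(_ nz').
    rewrite -eqw /w3 /= eqw' leq_add2r leq_eqVlt => /orP[/eqP eq_w|//].
    by case/eqP: neq; apply: weight_inj.
  have in_P3 : (i, j, k) \in P3.
    rewrite inE lt_ij lt_jk /=; apply/and3P; split.
    - exact: (dep _ _ k).
    - apply: (dep _ _ j); [exact: ltn_trans lt_jk | by rewrite -oppr_eq0 -om_swapr|].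
      by rewrite /w3 /=; lia.
    - apply: (dep _ _ i) => //; last by rewrite /w3 /=; lia.
      by rewrite om_swapr oppr_eq0 om_swapl oppr_eq0.
  by case/eqP: nz; apply: (xP3 (Sub (i, j, k) in_P3)).
case/rV0Pn: nz_x => k /negP[]; have /esym/eqP := om_contr k.
rewrite big1 => [|ij _]; last by rewrite om0 scale0r.
by rewrite scaler_eq0 (negPf nz_y) orbF.
Qed.
End JacobiPairing.

(** * Trilinear coboundaries *)

Section Coboundary.
Local Open Scope ring_scope.
Variables (F : fieldType) (n : nat).
Implicit Types (A B : 'rV[F]_n -> 'rV[F]_n -> 'rV[F]_n -> F) (i j k : 'I_n).

(** Up to sign, [A] is the differential of the 2-cochain [P] on the additive group of vectors, with
    trivial action. *)
Definition coboundary A := exists P : 'rV[F]_n -> 'rV[F]_n -> F,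
  forall u v w, A u v w = P u v + P (u + v) w - P v w - P u (v + w).

Lemma eq_coboundary A B :
  (forall u v w, A u v w = B u v w) -> coboundary A -> coboundary B.
Proof. by move=> eqAB [P defA]; exists P => u v w; rewrite -eqAB. Qed.

Lemma coboundary0 : coboundary (fun _ _ _ => 0).
Proof. by exists (fun _ _ => 0) => u v w; rewrite !subr0 addr0. Qed.

Lemma coboundaryD A B :
  coboundary A -> coboundary B -> coboundary (fun u v w => A u v w + B u v w).
Proof.
move=> [P defA] [Q defB]; exists (fun u v => P u v + Q u v) => u v w.
by rewrite defA defB; ring.
Qed.

Lemma coboundaryZ a A : coboundary A -> coboundary (fun u v w => a * A u v w).
Proof. by move=> [P defA]; exists (fun u v => a * P u v) => u v w; rewrite defA; ring. Qed.

Lemma coboundary_sum (I : finType) (A_ : I -> _) :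
  (forall x, coboundary (A_ x)) -> coboundary (fun u v w => \sum_x A_ x u v w).
Proof.
move=> cobA; elim: (index_enum I) => [|x s IHs].
  by apply: eq_coboundary coboundary0 => u v w; rewrite big_nil.
apply: eq_coboundary (coboundaryD (cobA x) IHs) => u v w.
by rewrite big_cons.
Qed.

Definition monomial i j k (u v w : 'rV[F]_n) := u 0 i * v 0 j * w 0 k.

(** The quadratic function [u 0 i * u 0 j] fails to be additive exactly by the symmetrised product
    of coordinates. *)
Lemma coboundary_swapl i j k :
  coboundary (fun u v w => monomial i j k u v w + monomial j i k u v w).
Proof.
by exists (fun u v => u 0 i * u 0 j * v 0 k) => u v w; rewrite /monomial !mxE; ring.
Qed.

Lemma coboundary_swapr i j k :
  coboundary (fun u v w => monomial i j k u v w + monomial i k j u v w).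
Proof.
by exists (fun u v => - (u 0 i * v 0 j * v 0 k)) => u v w; rewrite /monomial !mxE; ring.
Qed.

Hypothesis two_neq0 : 2%:R != 0 :> F.

(** With equal indices the swap relation yields twice the monomial, so [2] must be invertible. *)
Lemma coboundary_iij i k : coboundary (monomial i i k).
Proof.
apply: eq_coboundary (coboundaryZ 2%:R^-1 (coboundary_swapl i i k)) => u v w.
by rewrite /monomial; field.
Qed.

Lemma coboundary_ijj i j : coboundary (monomial i j j).
Proof.
apply: eq_coboundary (coboundaryZ 2%:R^-1 (coboundary_swapr i j j)) => u v w.
by rewrite /monomial; field.
Qed.

Lemma coboundary_iji i j : coboundary (monomial i j i).
Proof.
apply: eq_coboundary (coboundaryD (coboundary_swapr i j i)
  (coboundaryZ (-1) (coboundary_iij i j))) => u v w.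
by rewrite /monomial; ring.
Qed.

(* Modulo coboundaries a monomial is alternating in its indices, so only the
   monomials with increasing indices survive, with the Jacobi sums as
   coefficients; sorting avoids a division by 3. *)
Lemma coboundary_jacobi (T : 'I_n -> 'I_n -> 'I_n -> F) :
    (forall i j k, T i j k = - T j i k) ->
    (forall i j k, T i j k + T j k i + T k i j = 0) ->
  coboundary (fun u v w =>
    \sum_(i < n) \sum_(j < n) \sum_(k < n) (i < j)%N%:R * T j i k * monomial j i k u v w).
Proof.
move=> skewT jacT.
pose sorted i j k : F := (i < j < k)%N%:R.
(* A term with the signed sorted monomial that cancels it modulo coboundaries. At most one of the
   three sorting conditions holds, and none when [k] is [i] or [j]. *)
pose R i j k u v w := (i < j)%N%:R * T j i k * monomial j i k u v w
  + (sorted i j k * T j i k * monomial i j k u v w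
     - sorted i k j * T j i k * monomial i k j u v w
     + sorted k i j * T j i k * monomial k i j u v w).
have cobR i j k : coboundary (R i j k).
  rewrite /R /sorted.
  have [le_ji|lt_ij] := leqP j i.
    apply: eq_coboundary coboundary0 => u v w.
    have -> : (i < k < j)%N = false by lia.
    rewrite andbF /=. ring.
  have [lt_kj|lt_jk|/val_inj->{k}] := ltngtP k j; last first.
  - apply: eq_coboundary (coboundaryZ (T j i j) (coboundary_iji j i)) => u v w.
    have -> : (j < i)%N = false by lia.
    rewrite !andbF /=. ring.
  - have -> : (i < k)%N = true by lia.
    have -> : (k < i)%N = false by lia.
    apply: eq_coboundary (coboundaryZ (T j i k) (coboundary_swapl j i k)) => u v w.
    by rewrite /= ?andbF /=; ring.
  have [lt_ki|lt_ik|/val_inj->{k lt_kj}] := ltngtP k i; last first.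
  - apply: eq_coboundary (coboundaryZ (T j i i) (coboundary_ijj j i)) => u v w.
    by rewrite !andbF /=; ring.
  - apply: eq_coboundary (coboundaryD (coboundaryZ (T j i k) (coboundary_swapl j i k))
       (coboundaryZ (- T j i k) (coboundary_swapr i j k))) => u v w.
    by rewrite /= ?andbF /=; ring.
  - apply: eq_coboundary (coboundaryD (coboundaryZ (T j i k) (coboundary_swapr j i k))
       (coboundaryD (coboundaryZ (- T j i k) (coboundary_swapl j k i))
       (coboundaryZ (T j i k) (coboundary_swapr k j i)))) => u v w.
    by rewrite /= ?andbF /=; ring.
apply: eq_coboundary (coboundary_sum (fun i => coboundary_sum (fun j =>
  coboundary_sum (fun k => cobR i j k)))) => u v w.
rewrite /R; set X := RHS.
(* The added sum is zero by the Jacobi identity and supplies the sorted monomials that complete the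
   terms to [R]. *)
have -> : X = X + \sum_(i < n) \sum_(j < n) \sum_(k < n) sorted i j k *
  (T j i k - T k i j + T k j i) * monomial i j k u v w.
  rewrite [X in _ + X]big1 ?addr0 // => i _; rewrite big1 // => j _.
  rewrite big1 // => k _; have -> : T j i k - T k i j + T k j i = 0.
    have := jacT i j k; rewrite (skewT j i) (skewT k j) => jac0.
    by rewrite -[0]oppr0 -jac0; ring.
  by rewrite mulr0 mul0r.
have sum3D (f g : 'I_n -> 'I_n -> 'I_n -> F) :
    \sum_(i < n) \sum_(j < n) \sum_(k < n) (f i j k + g i j k)
    = \sum_(i < n) \sum_(j < n) \sum_(k < n) f i j k
      + \sum_(i < n) \sum_(j < n) \sum_(k < n) g i j k.
  rewrite -big_split; apply: eq_bigr => i _; rewrite -big_split /=.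
  by apply: eq_bigr => j _; rewrite -big_split.
have sum3N (f : 'I_n -> 'I_n -> 'I_n -> F) :
    \sum_(i < n) \sum_(j < n) \sum_(k < n) - f i j k
      = - \sum_(i < n) \sum_(j < n) \sum_(k < n) f i j k.
  rewrite -sumrN; apply: eq_bigr => i _; rewrite -sumrN.
  by apply: eq_bigr => j _; rewrite -sumrN.
rewrite sum3D; congr (_ + _); rewrite !sum3D sum3N.
under [in RHS]eq_bigr => i _ do under eq_bigr => j _ do under eq_bigr => k _ do
  rewrite mulrDr mulrBr !mulrDl mulNr.
rewrite !sum3D sum3N; congr (_ - _ + _).
  by apply: eq_bigr => i _; rewrite exchange_big.
under eq_bigr => i _ do rewrite exchange_big /=.
by rewrite exchange_big.
Qed.
End Coboundary.

(** * Capability from 2-cocycles *)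

Import GroupScope.

Definition cocycle (K : groupType) (A : zmodType) (c : K -> K -> A) : Prop :=
  forall x y z, (c x y + c (x * y)%g z = c y z + c x (y * z)%g)%R.

(** The cocycle proof is a parameter of the type, so that group laws depending on it can be attached
    to the type. *)
Definition central_extension (K : groupType) (A : zmodType) (c : K -> K -> A)
  of cocycle c : Type := (K * A)%type.

Section CentralExtension.
Variables (K : groupType) (A : zmodType) (c : K -> K -> A) (cc : cocycle c).
Local Notation H := (central_extension cc).
HB.instance Definition _ := Choice.on H.

(** Cocycles are not normalised, hence the correction [- c 1 1]. *)
Definition ext_one : H := (1%g, (- c 1 1)%R).
Definition ext_mul (x y : H) : H := ((x.1 * y.1)%g, (x.2 + y.2 + c x.1 y.1)%R).
Definition ext_inv (x : H) : H :=
  ((x.1)^-1%g, (- x.2 - c 1 1 - c x.1 (x.1)^-1)%R).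

Lemma cocycle1g x : c 1%g x = c 1%g 1%g.
Proof. by have := cc 1%g 1%g x; rewrite !mul1g => /addIr. Qed.

Lemma cocycleg1 x : c x 1%g = c 1%g 1%g.
Proof. by have := cc x 1%g 1%g; rewrite !mulg1 => /addIr. Qed.

Lemma cocycleVg x : c x^-1 x = c x x^-1.
Proof.
by have := cc x x^-1 x; rewrite mulgV mulVg cocycle1g cocycleg1 => /addIr.
Qed.

Lemma ext_mulA : associative ext_mul.
Proof.
move=> x y z; congr (_, _); first exact: mulgA.
by rewrite /= !addrA -[LHS]addrA -cc !addrA; congr (_ + _)%R; rewrite addrAC.
Qed.

Lemma ext_mul1g : left_id ext_one ext_mul.
Proof.
move=> [x a]; congr (_, _); first exact: mul1g.
by rewrite /= cocycle1g addrAC addNr add0r.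
Qed.

Lemma ext_mulg1 : right_id ext_one ext_mul.
Proof.
move=> [x a]; congr (_, _); first exact: mulg1.
by rewrite /= cocycleg1 addrNK.
Qed.

Lemma ext_mulVg : left_inverse ext_one ext_inv ext_mul.
Proof.
move=> [x a]; congr (_, _); first exact: mulVg.
by rewrite /= cocycleVg addrAC addrNK addrAC addNr add0r.
Qed.

Lemma ext_mulgV : right_inverse ext_one ext_inv ext_mul.
Proof.
move=> [x a]; congr (_, _); first exact: mulgV.
by rewrite /= !addrA addrNK addrN add0r.
Qed.

HB.instance Definition _ := isGroup.Build H
  ext_mulA ext_mul1g ext_mulg1 ext_mulVg ext_mulgV.

Lemma central_extensionM (x y : H) :
  (x * y = ((x.1 * y.1)%g, (x.2 + y.2 + c x.1 y.1)%R) :> H)%g.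
Proof. by []. Qed.

(** By hypothesis no element above some [g != 1] is central, so the centre is exactly the kernel of
    the first projection. *)
Lemma central_extension_capable :
  (forall g : K, g != 1%g -> exists h, (g * h, c g h) <> (h * g, c h g)) -> capable K.
Proof.
move=> separated; exists H.
have in_centerE (x : H) : in_center x = (x.1 == 1%g).
  apply/in_centerP/eqP => [cx|x1 y].
    apply: contrapT => /eqP /separated[h]; apply.
    have := cx (h, 0%R); rewrite !central_extensionM /= addr0 add0r.
    by case=> -> /addrI->.
  by rewrite !central_extensionM x1 mul1g mulg1 cocycle1g cocycleg1 [(x.2 + _)%R]addrC.
have eq_piP (x y : H) : x.1 = y.1 -> \pi_(central_quotient H)%qT x = \pi_(central_quotient H)%qT y.
  move=> eq1; apply/cq_piE; rewrite /eqmod_center in_centerE.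
  by rewrite central_extensionM /= eq1 mulVg.
exists (fun g => \pi_(central_quotient H)%qT (g, 0%R) : central_quotient H).
  move=> g h; rewrite [RHS]Defs.pi_mul; apply: eq_piP.
  by rewrite central_extensionM.
exists (fun q : central_quotient H => (repr q).1) => [g|q].
  have [z] := repr_pi ((g, 0%R) : H).
  by rewrite in_centerE => /eqP z1 ->; rewrite central_extensionM /= z1 mulg1.
by rewrite -[RHS]reprK; apply: eq_piP.
Qed.
End CentralExtension.

(** Each element may use its own cocycle: the whole family is a single cocycle with values in the
    functions from [K] to [A]. *)
Lemma capable_of_cocycles (K : finGroupType) (A : zmodType) :
    (forall g : K, g != 1%g ->
      exists2 c : K -> K -> A, cocycle c & exists h, (g * h, c g h) <> (h * g, c h g)) ->
  capable K.
Proof.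
move=> separated.
have /fin_all_exists[c sepc] : forall g : K, exists c : K -> K -> A, cocycle c /\
    (g != 1%g -> exists h, (g * h, c g h) <> (h * g, c h g)).
  move=> g; have [->|/separated[c cc sep_g]] := eqVneq g 1%g; last by exists c.
  by exists (fun _ _ => 0%R); split=> // x y z; rewrite !addr0.
pose C x y : {ffun K -> A} := [ffun g => c g x y].
have cC : cocycle C.
  by move=> x y z; apply/ffunP=> g; rewrite !ffunE (sepc g).1.
apply: (central_extension_capable cC) => g nt_g.
have [h neq_gh] := (sepc g).2 nt_g; exists h => -[eq_gh /ffunP/(_ g)].
by rewrite !ffunE => eq_c; apply: neq_gh; rewrite eq_gh eq_c.
Qed.

(** * Coordinates on a group of class two and prime exponent *)

Lemma abelem_coordinates p (gT : finGroupType) (E : {group gT}) n :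
    p.-abelem E -> 'r(E) = n ->
  exists phi : gT -> 'rV['F_p]_n,
    [/\ {in E &, {morph phi : x y / x * y >-> (x + y)%R}}, {in E &, injective phi}
      & forall v, exists2 x, x \in E & phi x = v].
Proof.
move=> abelE; rewrite (rank_abelem abelE) => <-{n}.
have [E1|ntE] := eqVneq (E : {set gT}) 1.
  rewrite E1 cards1 logn1; exists (fun=> 0%R); split=> [x y _ _|x y|v].
  - by rewrite addr0.
  - by rewrite !inE => /eqP-> /eqP->.
  - by exists 1; rewrite ?group1 // thinmx0.
rewrite -(dim_abelemE abelE ntE); exists (abelem_rV abelE ntE); split.
- exact: abelem_rV_M.
- exact: abelem_rV_inj.
- by move=> v; exists (rVabelem abelE ntE v); [apply: mem_rVabelem | apply: rVabelemK].
Qed.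

Section ClassTwo.
Variables (p : nat) (gT : finGroupType) (G : {group gT}) (n m : nat).
Hypotheses (p_pr : prime p) (sG'Z : G^`(1) \subset 'Z(G)) (expG : exponent G %| p).
Local Notation F := 'F_p.
Variables (phi : gT -> 'rV[F]_n) (psi : gT -> 'rV[F]_m) (e : 'I_n -> gT).
Hypothesis phiM : {in G &, {morph phi : x y / x * y >-> (x + y)%R}}.
Hypothesis phi_eq0 : {in G, forall x, (phi x == 0%R) = (x \in G^`(1))}.
Hypothesis psiM : {in G^`(1) &, {morph psi : x y / x * y >-> (x + y)%R}}.
Hypothesis psi_inj : {in G^`(1) &, injective psi}.
Hypothesis psi_onto : forall v, exists2 x, x \in G^`(1) & psi x = v.
Hypothesis eG : forall i, e i \in G.
Hypothesis phi_e : forall i, phi (e i) = delta_mx 0%R i.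

Let G'G : {subset G^`(1) <= G}. Proof. exact/subsetP/der_sub. Qed.

Let central x y : x \in G^`(1) -> y \in G -> x * y = y * x.
Proof. by move=> /(subsetP sG'Z)/centerP[_ cxG] /cxG. Qed.

Let phi1 : phi 1 = 0%R.
Proof. by have := phiM (group1 G) (group1 G); rewrite mulg1 -[LHS]addr0 => /addrI. Qed.

Let psi1 : psi 1 = 0%R.
Proof.
by have := psiM (group1 G^`(1)) (group1 G^`(1)); rewrite mulg1 -[LHS]addr0 => /addrI.
Qed.

Let phiV x : x \in G -> phi x^-1 = (- phi x)%R.
Proof.
by move=> Gx; apply/eqP; rewrite -addr_eq0 -phiM ?groupV // mulVg phi1.
Qed.

Let phi_der x : x \in G^`(1) -> phi x = 0%R.
Proof. by move=> G'x; apply/eqP; rewrite phi_eq0 ?G'G. Qed.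

Let commG' x y : x \in G -> y \in G -> [~ x, y] \in G^`(1).
Proof. exact: mem_commg. Qed.

Let conjG' x y : x \in G^`(1) -> y \in G -> x ^ y = x.
Proof. by move=> G'x Gy; rewrite conjgE (central G'x) // mulKg. Qed.

(** Commutators are central, so conjugation drops out and the commutator map is bilinear. *)
Let psi_commMl x y z : x \in G -> y \in G -> z \in G ->
  psi [~ x * y, z] = (psi [~ x, z] + psi [~ y, z])%R.
Proof. by move=> Gx Gy Gz; rewrite commMgJ conjG' ?commG' // psiM ?commG'. Qed.

Let psi_commMr x y z : x \in G -> y \in G -> z \in G ->
  psi [~ x, y * z] = (psi [~ x, z] + psi [~ x, y])%R.
Proof. by move=> Gx Gy Gz; rewrite commgMJ conjG' ?commG' // psiM ?commG'. Qed.

Let psi_commXl x y k : x \in G -> y \in G -> psi [~ x ^+ k, y] = (psi [~ x, y] *+ k)%R.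
Proof.
move=> Gx Gy; elim: k => [|k IHk]; first by rewrite comm1g psi1.
by rewrite expgS psi_commMl ?groupX // IHk mulrS.
Qed.

Let psi_commXr x y k : x \in G -> y \in G -> psi [~ x, y ^+ k] = (psi [~ x, y] *+ k)%R.
Proof.
move=> Gx Gy; elim: k => [|k IHk]; first by rewrite commg1 psi1.
by rewrite expgS psi_commMr ?groupX // IHk mulrS addrC.
Qed.

Let C i j := psi [~ e i, e j].

(** Elements of [F] serve as exponents through their natural representatives; [s] is arbitrary to
    allow induction. *)
Let tau (s : seq 'I_n) (u : 'rV[F]_n) := \prod_(i <- s) e i ^+ u 0%R i.

Let tauG s u : tau s u \in G.
Proof. by apply: group_prod => i _; rewrite groupX. Qed.

Let tau_cons i s u : tau (i :: s) u = e i ^+ u 0%R i * tau s u.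
Proof. by rewrite /tau big_cons. Qed.

Let psi_comm_tau s u x : x \in G ->
  psi [~ tau s u, x] = (\sum_(i <- s) u 0 i *: psi [~ e i, x])%R.
Proof.
move=> Gx; elim: s => [|i s IHs]; first by rewrite /tau !big_nil comm1g psi1.
by rewrite tau_cons psi_commMl ?groupX // psi_commXl // IHs big_cons -scaler_nat natr_Zp.
Qed.

(** Exponents may be reduced modulo [p], so no carries appear when normal forms are multiplied. *)
Let expD (a b : F) x : x \in G -> x ^+ (a + b)%R = x ^+ a * x ^+ b.
Proof.
move=> Gx; rewrite -expgD -[RHS](expg_mod _ (exponentP expG _ Gx)); congr (_ ^+ _).
exact: (congr1 (modn (a + b)%N) (Fp_cast p_pr)).
Qed.

(** Collection: moving [e i ^+ v 0 i] left past the tail of the first product creates a central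
    commutator, which contributes [(u 0 j * v 0 i) *: C j i] for each later [j]. *)
Let tauM s u v : sorted (fun i j : 'I_n => i < j) s ->
  exists2 z, z \in G^`(1) & tau s u * tau s v = tau s (u + v)%R * z /\
  psi z = (\sum_(i <- s) \sum_(j <- s | (i < j)%N) (u 0 j * v 0 i) *: C j i)%R.
Proof.
have lt_trans : transitive (fun i j : 'I_n => i < j) by move=> j i k; apply: ltn_trans.
elim: s => [|i s IHs] sorted_s.
  by exists 1; rewrite // /tau !big_nil !mulg1 psi1.
have [z G'z [def_z psi_z]] := IHs (path_sorted sorted_s).
have lt_i j : j \in s -> i < j
  by move: sorted_s; rewrite /= path_sortedE // => /andP[/allP lt_s _] /lt_s.
pose w := [~ tau s u, e i ^+ v 0%R i]; have G'w : w \in G^`(1) by rewrite commG' ?groupX.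
exists (z * w); first exact: groupM.
split.
  have tau_e : tau s u * e i ^+ v 0%R i = e i ^+ v 0%R i * tau s u * w := commgC _ _.
  rewrite !tau_cons mxE expD // -!mulgA; congr (_ * _).
  rewrite [LHS]mulgA tau_e -[LHS]mulgA (central G'w (tauG s v)) -!mulgA.
  by congr (_ * _); rewrite mulgA def_z -mulgA.
rewrite psiM // psi_z psi_comm_tau ?groupX // big_cons addrC; congr (_ + _)%R.
  rewrite big_cons ltnn [RHS]big_seq_cond [LHS]big_seq.
  apply: eq_big => [j|j js]; first by case: (boolP (j \in s)) => // /lt_i->.
  by rewrite psi_commXr // -scaler_nat natr_Zp scalerA.
rewrite big_seq [RHS]big_seq; apply: eq_bigr => j js.
by rewrite big_cons ifN // -leqNgt ltnW ?lt_i.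
Qed.

Let phi_tau u : phi (tau (enum 'I_n) u) = u.
Proof.
have phiX x k : x \in G -> phi (x ^+ k) = (phi x *+ k)%R.
  move=> Gx; elim: k => [|k IHk]; first by rewrite phi1.
  by rewrite expgS phiM ?groupX // IHk mulrS.
have -> : phi (tau (enum 'I_n) u) = (\sum_(i <- enum 'I_n) u 0 i *: delta_mx 0 i)%R.
  elim: (enum 'I_n) => [|i s IHs]; first by rewrite /tau !big_nil phi1.
  by rewrite tau_cons phiM ?groupX // IHs phiX // phi_e big_cons -scaler_nat natr_Zp.
by rewrite big_enum [RHS]row_sum_delta.
Qed.

Let red x := (tau (enum 'I_n) (phi x))^-1 * x.

Let redG' x : x \in G -> red x \in G^`(1).
Proof.
move=> Gx; rewrite -phi_eq0 ?groupM ?groupV // phiM ?groupV //.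
by rewrite phiV // phi_tau addNr.
Qed.

Let red_der x : x \in G^`(1) -> red x = x.
Proof.
move=> G'x; rewrite /red phi_der // /tau big1 ?invg1 ?mul1g // => i _.
by rewrite mxE.
Qed.

Let psi_redM x y : x \in G -> y \in G ->
  psi (red (x * y)) = (psi (red x) + psi (red y) +
    \sum_(i < n) \sum_(j < n | (i < j)%N) (phi x 0 j * phi y 0 i) *: C j i)%R.
Proof.
move=> Gx Gy.
have sorted_enum : sorted (fun i j : 'I_n => i < j) (enum 'I_n).
  by have := iota_ltn_sorted 0 n; rewrite -val_enum_ord sorted_map.
have [z G'z [def_z psi_z]] := tauM (phi x) (phi y) sorted_enum.
have redK a : a = tau (enum 'I_n) (phi a) * red a by rewrite mulKVg.
have -> : red (x * y) = z * (red x * red y).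
  rewrite [red (x * y)]/red phiM //; apply: (canLR (mulKg _)).
  move: (redG' Gx) (tauG (enum 'I_n) (phi y)) (redK x) (redK y).
  move: (red x) (red y) => rx ry G'rx Gty def_x def_y.
  rewrite [RHS]mulgA -def_z {1}def_x {1}def_y -!mulgA; congr (_ * _).
  by rewrite [LHS]mulgA (central G'rx Gty) -mulgA.
move: (redG' Gx) (redG' Gy); move: (red x) (red y) => rx ry G'rx G'ry.
rewrite psiM ?groupM // psiM // addrC; congr (_ + _)%R.
rewrite psi_z big_enum; apply: eq_bigr => i _.
by rewrite big_enum_cond.
Qed.

Let psi_commE x y : x \in G -> y \in G ->
  psi [~ x, y] = (\sum_(i < n) phi x 0 i *: psi [~ e i, y])%R.
Proof.
move=> Gx Gy.
have : x = tau (enum 'I_n) (phi x) * red x by rewrite mulKVg.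
move: (redG' Gx) (tauG (enum 'I_n) (phi x)); move: (red x) => rx G'rx Gtx {1}->.
rewrite psi_commMl ?(G'G G'rx) // psi_comm_tau // big_enum.
have -> : [~ rx, y] = 1 by apply/eqP/commgP/central.
by rewrite psi1 addr0.
Qed.

Let skew_comm x y : x \in G -> y \in G -> psi [~ x, y] = (- psi [~ y, x])%R.
Proof.
move=> Gx Gy; apply/eqP; rewrite -addr_eq0 -psiM ?commG' //.
by rewrite -[[~ y, x]]invg_comm mulgV psi1.
Qed.

Let spanC (U : 'M[F]_m) : (forall i j, (C i j <= U)%MS) -> row_full U.
Proof.
move=> CU; rewrite -sub1mx; apply/row_subP=> k.
have [x G'x <-] := psi_onto (row k 1%:M%R).
(* These elements form a subgroup containing all commutators, hence the whole derived subgroup. *)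
pose K := [set x in G^`(1) | (psi x <= U)%MS].
have gK : group_set K.
  apply/group_setP; split=> [|y z]; first by rewrite inE group1 psi1 sub0mx.
  rewrite !inE => /andP[G'y Uy] /andP[G'z Uz].
  by rewrite groupM //= psiM // addmx_sub.
suffices /subsetP sub : G^`(1) \subset Group gK by move/sub: G'x; rewrite inE => /andP[].
rewrite gen_subG; apply/subsetP=> _ /imset2P[y z Gy Gz ->].
rewrite inE commG' //= psi_commE // summx_sub // => i _; rewrite scalemx_sub //.
rewrite skew_comm // eqmx_opp psi_commE // summx_sub // => j _.
by rewrite scalemx_sub ?CU.
Qed.

(* [t] is the second coordinate of [x] in the normal form
   [e_0 ^+ u_0 * ... * e_(n-1) ^+ u_(n-1) * z] with [z] in [G^`(1)]. *)
Lemma class2_normal_form :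
  exists (t : gT -> 'rV[F]_m) (C : 'I_n -> 'I_n -> 'rV[F]_m),
  [/\ {in G &, forall x y, t (x * y) = (t x + t y +
        \sum_(i < n) \sum_(j < n | (i < j)%N) (phi x 0 j * phi y 0 i) *: C j i)%R},
      {in G, forall x, phi x = 0%R -> t x = 0%R -> x = 1},
      forall i j, C i j = (- C j i)%R,
      forall i, C i i = 0%R
    & forall U : 'M[F]_m, (forall i j, (C i j <= U)%MS) -> row_full U].
Proof.
exists (psi \o red), C; split=> //=.
- move=> x Gx /eqP; rewrite phi_eq0 // => G'x; rewrite red_der // => psi_x0.
  by apply: psi_inj; rewrite ?psi1.
- by move=> i j; apply: skew_comm.
- by move=> i; rewrite /C commgg psi1.
Qed.
End ClassTwo.

Lemma class2_coordinates p (gT : finGroupType) (G : {group gT}) n m :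
    prime p -> nil_class G <= 2 -> exponent G %| p ->
    'r(G / G^`(1)) = n -> 'r(G^`(1)) = m ->
  exists (phi : gT -> 'rV['F_p]_n) (t : gT -> 'rV['F_p]_m)
         (C : 'I_n -> 'I_n -> 'rV['F_p]_m),
  [/\ [/\ {in G &, {morph phi : x y / x * y >-> (x + y)%R}},
          forall v, exists2 x, x \in G & phi x = v,
          {in G &, forall x y, t (x * y) = (t x + t y +
            \sum_(i < n) \sum_(j < n | (i < j)%N) (phi x 0 j * phi y 0 i) *: C j i)%R}
        & {in G, forall x, phi x = 0%R -> t x = 0%R -> x = 1}],
      forall i j, C i j = (- C j i)%R,
      forall i, C i i = 0%R
    & forall U : 'M['F_p]_m, (forall i j, (C i j <= U)%MS) -> row_full U].
Proof.
move=> p_pr; rewrite nil_class2 => sG'Z expG rank_ab rank_der.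
have nG'G : G \subset 'N(G^`(1)) := der_norm 1 G.
have abelQ : p.-abelem (G / G^`(1)).
  by rewrite abelemE // der_abelian (dvdn_trans (exponent_quotient _ _) expG).
have abelD : p.-abelem G^`(1).
  rewrite abelemE // (dvdn_trans (exponentS (der_sub 1 G)) expG) andbT.
  exact: abelianS sG'Z (center_abelian G).
have [phiQ [phiQM phiQ_inj phiQ_onto]] := abelem_coordinates abelQ rank_ab.
have [psi [psiM psi_inj psi_onto]] := abelem_coordinates abelD rank_der.
pose phi x := phiQ (coset G^`(1) x).
have phiM : {in G &, {morph phi : x y / x * y >-> (x + y)%R}}.
  move=> x y Gx Gy; rewrite /phi morphM ?(subsetP nG'G) //.
  by rewrite phiQM ?mem_quotient.
have phiQ1 : phiQ 1 = 0%R.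
  by have := phiQM _ _ (group1 (G / G^`(1))) (group1 _); rewrite mulg1 -[LHS]addr0 => /addrI.
have phi_eq0 : {in G, forall x, (phi x == 0%R) = (x \in G^`(1))}.
  move=> x Gx; rewrite -phiQ1 /phi (inj_in_eq phiQ_inj) ?group1 ?mem_quotient //.
  by apply/eqP/idP=> [/coset_idr-> //|]; [apply: (subsetP nG'G) | apply: coset_id].
have phi_onto v : exists2 x, x \in G & phi x = v.
  have [_ /morphimP[x _ Gx ->] <-] := phiQ_onto v; by exists x.
have /fin_all_exists2[e eG phi_e] : forall i : 'I_n, exists2 x, x \in G & phi x = delta_mx 0%R i.
  by move=> i; apply: phi_onto.
have [t [C [tM inj_t skewC altC spanC]]] :=
  class2_normal_form p_pr sG'Z expG phiM phi_eq0 psiM psi_inj psi_onto eG phi_e.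
by exists phi, t, C.
Qed.

(** * The Jacobi cocycle *)

Section JacobiCocycle.
Local Open Scope ring_scope.
Variables (F : fieldType) (n m : nat) (C : 'I_n -> 'I_n -> 'rV[F]_m) (N : 'M[F]_(m, n)).
Hypothesis two_neq0 : 2%:R != 0 :> F.
Hypothesis skewC : forall i j, C i j = - C j i.
Hypothesis jacC : forall i j k, (C i j *m N) 0 k + (C j k *m N) 0 i + (C k i *m N) 0 j = 0.

Definition pairing (a : 'rV[F]_m) (v : 'rV[F]_n) : F := \sum_k (a *m N) 0 k * v 0 k.

Lemma pairingDl a b v : pairing (a + b) v = pairing a v + pairing b v.
Proof. by rewrite -big_split; apply: eq_bigr => k _; rewrite mulmxDl mxE mulrDl. Qed.

Lemma pairingDr a u v : pairing a (u + v) = pairing a u + pairing a v.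
Proof. by rewrite -big_split; apply: eq_bigr => k _; rewrite [(u + v) _ _]mxE mulrDr. Qed.

Lemma pairing0r a : pairing a 0 = 0.
Proof. by apply: big1 => k _; rewrite [X in _ * X]mxE mulr0. Qed.

Lemma pairing_delta a k : pairing a (delta_mx 0 k) = (a *m N) 0 k.
Proof.
rewrite /pairing (bigD1 k) //= [X in _ * X]mxE !eqxx mulr1 big1 ?addr0 // => l nlk.
by rewrite [X in _ * X]mxE (negPf nlk) andbF mulr0.
Qed.

(** As [t] is not additive, [pairing (t x) (phi y)] fails the cocycle identity by this left side;
    subtracting [P] repairs it. The equality [P 0 u = P u 0] makes the correction symmetric at
    elements with [phi] zero. *)
Lemma commutator_coboundary : exists P : 'rV[F]_n -> 'rV[F]_n -> F,
  [/\ forall u v w : 'rV[F]_n,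
        pairing (\sum_(i < n) \sum_(j < n | (i < j)%N) (u 0 j * v 0 i) *: C j i) w
        = P u v + P (u + v) w - P v w - P u (v + w)
    & forall u, P 0 u = P u 0].
Proof.
have skewT i j k : (C i j *m N) 0 k = - (C j i *m N) 0 k by rewrite skewC mulNmx mxE.
have [P defP] := coboundary_jacobi two_neq0 skewT jacC.
exists P; split=> [u v w|u].
  rewrite -defP /pairing mulmx_suml.
  under eq_bigr => k _ do rewrite summxE mulr_suml.
  rewrite exchange_big /=; apply: eq_bigr => i _.
  under eq_bigr => k _ do rewrite mulmx_suml summxE mulr_suml.
  rewrite exchange_big /= big_mkcond; apply: eq_bigr => j _.
  case: ifP => _; last by rewrite big1 // => k _; rewrite !mul0r.
  by apply: eq_bigr => k _; rewrite -scalemxAl mxE /monomial mul1r; ring.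
(* The trilinear sum vanishes at a zero middle argument, which gives [P v 0 = P 0 w]. *)
have zero_mid (v w : 'rV[F]_n) : 0 = P v 0 + P v w - P 0 w - P v w.
  transitivity (P v 0 + P (v + 0) w - P 0 w - P v (0 + w)); last by rewrite addr0 add0r.
  rewrite -defP; symmetry.
  by apply: big1 => i _; apply: big1 => j _; apply: big1 => k _;
    rewrite /monomial [(0 : 'rV_n) _ _]mxE; ring.
by apply/esym/eqP; rewrite -subr_eq0; apply/eqP; rewrite [RHS](zero_mid u u); ring.
Qed.

End JacobiCocycle.

(** * Separating every nontrivial element by a cocycle *)

Theorem theorem5p26 (p : nat) (p_pr : prime p) (p_odd : odd p)
    (gT : finGroupType) (G : {group gT})
    (nilG : nilpotent G) (classG : nil_class G <= 2)
    (expG : exponent G = p)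
    (n m : nat) (n_gt1 : 1 < n)
    (rank_ab : 'r(G / G^`(1)) = n)
    (rank_der : 'r(G^`(1)) = m)
    (f_lt : f ('C(n, 2) - m + 1) < n) :
  capable (subg_of G).
Proof.
have expGp : exponent G %| p by rewrite expG.
have [phi [t [C [[phiM phi_onto tM t_inj] skewC altC spanC]]]] :=
  class2_coordinates p_pr classG expGp rank_ab rank_der.
have two_neq0 : (2%:R != 0 :> 'F_p)%R.
  rewrite -(dvdn_pcharf (pchar_Fp p_pr)); apply/negP => /dvdn_leq => /(_ isT) le_p2.
  have := prime_gt1 p_pr; case: (p) p_odd le_p2 => [|[|[|]]] //.
apply: (@capable_of_cocycles (subg_of G) 'F_p) => g nt_g.
pose Gg (x : subg_of G) : sgval x \in G := subgP x.
have phig (x y : subg_of G) : phi (sgval (x * y)) = (phi (sgval x) + phi (sgval y))%R.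
  by rewrite -phiM.
(* Outside the derived subgroup, a product of two distinct coordinates is a bilinear cocycle that is
   not symmetric at [g]. *)
have [phi_g0|/rV0Pn[i nz_i]] := eqVneq (phi (sgval g)) 0%R; last first.
  have [j neq_ji] : exists j : 'I_n, j != i.
    have [i0|i_gt0] := posnP i.
      by exists (Ordinal n_gt1); rewrite -val_eqE /= i0.
    by exists (Ordinal (ltnW n_gt1)); rewrite -val_eqE /= neq_ltn i_gt0.
  exists (fun x y => phi (sgval x) 0 i * phi (sgval y) 0 j)%R.
    by move=> x y z; rewrite !phig !mxE; ring.
  have [h Gh phi_h] := phi_onto (delta_mx 0%R j).
  exists (subg G h) => /(congr1 snd)/=; rewrite subgK // phi_h !mxE !eqxx (eq_sym i) (negPf neq_ji).
  by rewrite /= mulr1 mul0r; apply/eqP.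
have nz_t : t (sgval g) != 0%R.
  apply: contra nt_g => /eqP t_g0; apply/eqP/val_inj; exact: (t_inj _ (Gg g)).
have [N jacN /rV0Pn[k nz_k]] := exists_jacobi_pairing skewC altC spanC nz_t f_lt.
have [P [defP P0]] := commutator_coboundary two_neq0 skewC jacN.
exists (fun x y => pairing N (t (sgval x)) (phi (sgval y)) - P (phi (sgval x)) (phi (sgval y)))%R.
  move=> x y z; rewrite !phig tM // !pairingDl pairingDr defP; ring.
(* The [P] terms of [c g h] and [c h g] agree since [phi g] is zero; the pairing terms are entry [k]
   of [t g *m N] and [0]. *)
have [h Gh phi_h] := phi_onto (delta_mx 0%R k).
exists (subg G h) => /(congr1 snd)/=; rewrite subgK // phi_h phi_g0 pairing_delta pairing0r P0.
by move/addIr/eqP; apply/negP.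
Qed.
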